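(* For any integer $d>0$, there exists a deterministic algorithm in the adversarial comparator model (against an adaptive adversary) that, on $n$ input items, takes $d$ rounds, makes $n^{1+2/\sqrt{d}}\,d$ comparisons, and returns a $2d$-approximate sorting.
   Context: Adversarial comparator model: we are given $n$ items with unknown real values, accessible only through a comparator which, given two items $x_i,x_j$, returns $\max\{x_i,x_j\}$ if $|x_i-x_j|>1$, and otherwise returns either one as chosen by an adversary; the adversary is adaptive. In the round model, in each round the algorithm submits a set of comparisons, chosen based on answers of previous rounds, and receives all answers. For reals $a,b$ write $a\ge_k b$ if $a\ge b-k$. An ordering $y_1,\dots,y_n$ of the items is a $k$-approximate sorting if $y_j\ge_k y_i$ for all $j>i$. *)

(* Defs.v *)
From mathcomp Require Import all_boot all_order all_fingroup all_algebra.
From mathcomp Require Import all_classical all_reals all_analysis.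

Set Implicit Arguments.
Unset Strict Implicit.
Unset Printing Implicit Defensive.

Import Order.TTheory GRing.Theory Num.Theory.

Local Open Scope ring_scope.

(* The n items are the indices 'I_n.  The pair (i, j) denotes the comparison  *)
(* of items i and j; its answer is the item returned by the comparator.       *)
Definition comparison (n : nat) : finType := ('I_n * 'I_n)%type.

(* What the algorithm learns in one round: [Some k] if the comparison was     *)
(* submitted and answered k, [None] if it was not submitted.                  *)
Definition round_answers (n : nat) := {ffun comparison n -> option 'I_n}.

(* Answers of the rounds completed so far, oldest round first. *)
Definition history (n : nat) := seq (round_answers n).

(* A deterministic algorithm on n items sees only the answers it received,    *)
(* never the values.  The output s lists the items as s 0, s 1, ..., s (n-1). *)
Record algorithm (n : nat) := Algorithm {
  rounds : nat;
  query : history n -> {set comparison n};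
  output : history n -> 'S_n
}.

(* An adaptive adversary answers each comparison of a round knowing all       *)
(* previous answers and the whole set submitted in the current round; a       *)
(* comparison submitted again in a later round may be answered differently.   *)
Definition adversary (n : nat) :=
  history n -> {set comparison n} -> comparison n -> 'I_n.

Definition valid_answer (R : realType) (n : nat) (x : 'I_n -> R)
    (c : comparison n) (k : 'I_n) : Prop :=
  (k = c.1 \/ k = c.2) /\
  (1 < `|x c.1 - x c.2| -> x k = Num.max (x c.1) (x c.2)).

Definition valid_adversary (R : realType) (n : nat) (x : 'I_n -> R)
    (adv : adversary n) : Prop :=
  forall (h : history n) (Q : {set comparison n}) (c : comparison n),
    c \in Q -> valid_answer x c (adv h Q c).

Definition answer_round (n : nat) (Q : {set comparison n})
    (ans : comparison n -> 'I_n) : round_answers n :=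
  [ffun c => if c \in Q then Some (ans c) else None].

Fixpoint transcript (n : nat) (A : algorithm n) (adv : adversary n) (t : nat)
    : history n :=
  if t is t'.+1 then
    let h := transcript A adv t' in
    rcons h (answer_round (query A h) (adv h (query A h)))
  else [::].

Definition num_comparisons (n : nat) (A : algorithm n) (adv : adversary n)
    : nat :=
  (\sum_(t < rounds A) #|query A (transcript A adv t)|)%N.

Definition result (n : nat) (A : algorithm n) (adv : adversary n) : 'S_n :=
  output A (transcript A adv (rounds A)).

Definition approx_ge (R : realType) (k a b : R) : Prop := b - k <= a.

Definition approx_sorting (R : realType) (n : nat) (k : R) (x : 'I_n -> R)
    (s : 'S_n) : Prop :=
  forall i j : 'I_n, (i < j)%N -> approx_ge k (x (s j)) (x (s i)).

(* Main.v *)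
Require Import Defs.
From mathcomp Require Import all_boot all_order all_fingroup all_algebra.
From mathcomp Require Import all_classical all_reals all_analysis.
From mathcomp Require Import zify ring lra.

Set Implicit Arguments.
Unset Strict Implicit.
Unset Printing Implicit Defensive.

Import Order.TTheory GRing.Theory Num.Theory.

Local Open Scope ring_scope.

(* Ordering a group by its numbers of wins in a round-robin is a 2-approximate
   sorting.  To split a set into small buckets, repeatedly cut it into groups,
   sort each group this way and keep every s-th item; when few items are left
   after tau rounds they serve as pivots, and every item is compared with every
   pivot.  An adaptive adversary may answer all these last comparisons so that
   one bucket gets everything, but the sampling rounds already certify, up to
   an error 2 tau, that an item is below some pivot and above another one.  The
   bucket suggested by the comparisons is clamped to that certified range; a
   counting argument over the sampling levels then bounds all buckets.  Buckets
   are processed recursively in parallel.  With 2 s^2 pivots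
   and groups of 2 tau s^2, a set of 2 s^(k+2) items is sorted in
   (k^2 + 3k + 2) / 2 rounds with O(k^2 s^2) comparisons per item, and s, k are
   chosen from n and d. *)

(** * Strategies as a game on knowledge, and their translation into algorithms *)

Section Reach.
Variables (R : realType) (n : nat).

Definition knowledge := ('I_n -> R) -> Prop.

Implicit Types (K : knowledge) (G : knowledge -> Prop).

Definition learn K (Q : {set comparison n}) (r : comparison n -> 'I_n)
    : knowledge :=
  fun x => K x /\ forall c, c \in Q -> valid_answer x c (r c).

(* The game in which the algorithm has t rounds and c comparisons left to bring
   its knowledge, starting from K, into G, whatever the answers r. *)
Fixpoint reach (t : nat) (c : R) K G : Prop :=
  if t is t'.+1 then
    exists Q : {set comparison n},
      forall r, reach t' (c - #|Q|%:R) (learn K Q r) G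
  else 0 <= c /\ G K.

Definition implies K' K := forall x, K' x -> K x.

(** Further answers never spoil such a goal, which lets strategies run side by side. *)
Definition antitone G := forall K K', implies K' K -> G K -> G K'.

Lemma learn_sub K K' (Q Q' : {set comparison n}) r : implies K' K -> Q \subset Q' ->
  implies (learn K' Q' r) (learn K Q r).
Proof.
by move=> sK /fintype.subsetP sQ x [Kx rx]; split=> [|c cQ]; [exact: sK | exact/rx/sQ].
Qed.

Lemma reach_weaken t c c' K K' G : antitone G -> c <= c' -> implies K' K ->
  reach t c K G -> reach t c' K' G.
Proof.
move=> aG; elim: t c c' K K' => [|t IH] c c' K K' lec sK /=.
  by case=> c0 GK; split; [exact: le_trans lec | exact: aG GK].
case=> Q HQ; exists Q => r; apply: IH (HQ r); first by rewrite lerD2r.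
exact: learn_sub.
Qed.

Lemma reach_imply t c K G G' :
  (forall K', implies K' K -> G K' -> G' K') ->
  reach t c K G -> reach t c K G'.
Proof.
elim: t c K => [|t IH] c K GG' /=.
  by case=> c0 GK; split=> //; apply: GG'.
case=> Q HQ; exists Q => r; apply: IH (HQ r) => K' sK'; apply: GG'.
by move=> x /sK' [].
Qed.

Lemma reach_seq t1 t2 c1 c2 K G1 G2 :
  reach t1 c1 K G1 ->
  (forall K', implies K' K -> G1 K' -> reach t2 c2 K' G2) ->
  antitone G2 ->
  reach (t1 + t2) (c1 + c2) K G2.
Proof.
move=> + + aG; elim: t1 c1 K => [|t IH] c1 K /=.
  case=> c0 GK H; apply: reach_weaken (H _ _ GK) => //.
  by rewrite lerDr.
case=> Q HQ H; exists Q => r; rewrite addrAC; apply: IH (HQ r) _ => K' sK'.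
by apply: H => x /sK' [].
Qed.

Lemma reach_idle t t' c K G : antitone G -> (t <= t')%N ->
  reach t c K G -> reach t' c K G.
Proof.
move=> aG /subnK <-; elim: (t' - t)%N => // m IH /IH H.
exists finset.set0 => r; apply: reach_weaken H => //; last by move=> x [].
by rewrite cards0 subr0.
Qed.

(** Parallel play: each round submits the union of both query sets. Each strategy then sees extra
    answers, harmless because its goal is antitone. *)
Lemma reach_and t c1 c2 K G1 G2 : antitone G1 -> antitone G2 ->
  reach t c1 K G1 -> reach t c2 K G2 ->
  reach t (c1 + c2) K (fun K' => G1 K' /\ G2 K').
Proof.
move=> a1 a2; elim: t c1 c2 K => [|t IH] c1 c2 K /=.
  by case=> c10 G1K [c20 G2K]; split=> //; apply: addr_ge0.
case=> Q1 H1 [Q2 H2]; exists (Q1 :|: Q2) => r.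
have a12 : antitone (fun K' => G1 K' /\ G2 K').
  by move=> K1 K2 s12 [g1 g2]; split; [exact: a1 g1 | exact: a2 g2].
have {H1} H1 : reach t (c1 - #|Q1|%:R) (learn K (Q1 :|: Q2) r) G1.
  by apply: reach_weaken (H1 r) => //; apply: learn_sub => //; exact: finset.subsetUl.
have {H2} H2 : reach t (c2 - #|Q2|%:R) (learn K (Q1 :|: Q2) r) G2.
  by apply: reach_weaken (H2 r) => //; apply: learn_sub => //; exact: finset.subsetUr.
apply: reach_weaken (IH _ _ _ H1 H2) => //.
have : (#|Q1 :|: Q2| <= #|Q1| + #|Q2|)%N by rewrite -cardsUI leq_addr.
by rewrite -(ler_nat R) natrD; lra.
Qed.

Lemma reach_all (I : eqType) (s : seq I) t (c : I -> R) K
    (G : I -> knowledge -> Prop) :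
  (forall i, i \in s -> antitone (G i)) ->
  (forall i, i \in s -> reach t (c i) K (G i)) ->
  reach t (\sum_(i <- s) c i) K (fun K' => forall i, i \in s -> G i K').
Proof.
elim: s => [|i s IH] aG H.
  rewrite big_nil; apply: (@reach_idle 0) => //; split=> //.
rewrite big_cons.
have aGs : forall j, j \in s -> antitone (G j).
  by move=> j js; apply: aG; rewrite inE js orbT.
have Hs : forall j, j \in s -> reach t (c j) K (G j).
  by move=> j js; apply: H; rewrite inE js orbT.
have as_ : antitone (fun K' => forall i0 : I, i0 \in s -> G i0 K').
  by move=> K1 K2 s12 h j js; apply: aGs (h _ js).
apply: reach_imply (reach_and _ as_ (H i _) (IH aGs Hs)).
- by move=> K' _ [gi gs] j; rewrite inE => /orP[/eqP->|/gs].
- by apply: aG; rewrite inE eqxx.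
- by rewrite inE eqxx.
Qed.

Definition shift_adversary (a : round_answers n) (adv : adversary n)
  : adversary n := fun h => adv (a :: h).

Lemma transcript_shift (A A' : algorithm n) adv t :
  let a := answer_round (query A [::]) (adv [::] (query A [::])) in
  (forall h, query A' h = query A (a :: h)) ->
  transcript A adv t.+1 = a :: transcript A' (shift_adversary a adv) t.
Proof.
move=> a qA; elim: t => [//|t IH].
rewrite [LHS]/= -/(transcript A adv t.+1) IH /= !qA //.
Qed.

(** The answers of the first round select, by choice, an algorithm for the remaining rounds, which
    is run on the tail of the history. *)
Lemma algorithm_of_reach t c K G (Post : ('I_n -> R) -> 'S_n -> Prop) :
  (forall K', G K' -> exists s, forall x, K' x -> Post x s) ->
  reach t c K G ->
  exists A : algorithm n, rounds A = t /\
    forall x adv, K x -> valid_adversary x adv ->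
      (num_comparisons A adv)%:R <= c /\ Post x (result A adv).
Proof.
move=> GP; elim: t c K => [|t IH] c K /=.
  case=> c0 /GP[s Hs]; exists (Algorithm 0 (fun=> finset.set0) (fun=> s)).
  split=> // x adv Kx vx; split; last exact: Hs.
  by rewrite /num_comparisons big_ord0.
case=> Q HQ.
have /choice[B HB] : forall r : comparison n -> 'I_n, exists A : algorithm n,
    rounds A = t /\ forall x adv, learn K Q r x -> valid_adversary x adv ->
      (num_comparisons A adv)%:R <= c - #|Q|%:R /\ Post x (result A adv).
  by move=> r; apply: IH (HQ r).
(* The default covers comparisons outside [Q], on which [learn] puts no constraint. *)
pose dec (a : round_answers n) (cc : comparison n) := odflt cc.1 (a cc).
pose A := Algorithm t.+1
  (fun h => if h is a :: h' then query (B (dec a)) h' else Q)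
  (fun h => if h is a :: h' then output (B (dec a)) h' else 1%g).
exists A; split=> // x adv Kx vx.
set a := answer_round Q (adv [::] Q).
have tr u : transcript A adv u.+1 =
    a :: transcript (B (dec a)) (shift_adversary a adv) u.
  exact: transcript_shift.
have lx : learn K Q (dec a) x.
  by split=> // cc cQ; rewrite /dec ffunE cQ /=; apply: vx.
have vs : valid_adversary x (shift_adversary a adv) by move=> h; apply: vx.
have [rB /(_ x _ lx vs)[nB PB]] := HB (dec a).
split; last by rewrite /result [rounds A]/= tr /= -rB.
rewrite /num_comparisons [rounds A]/= big_ord_recl natrD -lerBrDl.
apply: le_trans nB; rewrite ler_nat /num_comparisons rB.
apply: eq_leq; apply: eq_bigr => i _.
by rewrite (_ : nat_of_ord (lift ord0 i) = i.+1) // tr.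
Qed.

End Reach.

(** * Sorting by number of wins in a round-robin *)

Section Wins.
Variables (R : realType) (n : nat).
Implicit Types (x : 'I_n -> R) (l : seq 'I_n) (e : R).

Definition ascending e x l := pairwise (fun i j => x i - e <= x j) l.

Definition compatible (beats : rel 'I_n) l x :=
  forall i j, i \in l -> j \in l -> i != j ->
    (beats i j -> x j - 1 <= x i) /\ (x j + 1 < x i -> beats i j).

Definition wins (beats : rel 'I_n) l i :=
  count (fun j => (j != i) && beats i j) l.

(** Whatever [j] beats has value at most [x j + 1 < x i - 1], so [i] beats it too; moreover [i]
    beats [j], which is no win of [j]. *)
Lemma wins_lt beats l x i j : i \in l -> j \in l -> compatible beats l x ->
  x j + 2 < x i -> (wins beats l j < wins beats l i)%N.
Proof.
move=> il jl comp ltji.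
have nij : i != j by apply: contraTneq ltji => ->; rewrite -leNgt; lra.
rewrite /wins.
have -> : (count (fun k => (k != j) && beats j k) l).+1 =
    ((count (fun k => (k != j) && beats j k) l) + 1)%N by rewrite addn1.
apply: (@leq_trans (count (fun k => (k != j) && beats j k) l +
                    count (pred1 j) l)%N).
  by rewrite leq_add2l -has_count has_pred1.
rewrite -count_predUI (_ : count (predI _ _) l = 0%N) ?addn0; last first.
  by apply/eqP; rewrite -leqn0 leqNgt -has_count; apply/hasPn => k _ /=;
     case: eqP => _; rewrite ?andbF.
rewrite -!size_filter; apply: (@leq_trans (size
  [seq k <- [seq k <- l | (k != i) && beats i k] |
    predU (fun k => (k != j) && beats j k) (pred1 j) k])); last first.
  by rewrite size_filter count_size.
rewrite -filter_predI; apply: eq_leq; congr size; apply: eq_in_filter => k kl /=.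
case: eqP => [->|/eqP nkj] /=.
  by rewrite eq_sym nij; have [_ ->] := comp i j il jl nij => //; lra.
rewrite orbF; case bjk: (beats j k) => //=.
have njk : j != k by rewrite eq_sym.
have [/(_ bjk) xk _] := comp j k jl kl njk.
have nki : k != i by apply: contraTneq ltji => eki; rewrite -leNgt -eki; lra.
rewrite nki /=; have [|_ -> //] := comp i k il kl; first by rewrite eq_sym.
by lra.
Qed.

(** The order is computed from [beats] alone, so one list serves all compatible value vectors. *)
Lemma sort_by_wins beats l : exists2 l', perm_eq l' l &
  forall x, compatible beats l x -> ascending 2 x l'.
Proof.
pose r : rel 'I_n := fun i j => (wins beats l i <= wins beats l j)%N.
exists (sort r l); first by rewrite perm_sort.
move=> x comp.
have tot : total r by move=> i j; exact: leq_total.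
have tr : transitive r by move=> i j k; exact: leq_trans.
have : pairwise r (sort r l) by rewrite -sorted_pairwise // sort_sorted.
apply: sub_in_pairwise (allss _) => i j; rewrite !mem_sort => il jl.
rewrite /r leqNgt; apply: contraNT; rewrite -ltNge => lt.
by apply: wins_lt comp _ => //; lra.
Qed.

Lemma valid_answer_le x i j k : valid_answer x (i, j) k ->
  (k = i -> x j - 1 <= x i) /\ (k != i -> x i - 1 <= x j).
Proof.
case=> /= kij h; split=> [ki|nki].
- case: (leP (x j - 1) (x i)) => // lt.
  have : x k = Num.max (x i) (x j) by apply: h; rewrite ltr0_norm; lra.
  by rewrite ki max_r; lra.
- have {kij nki} kj : k = j by case: kij nki => // ->; rewrite eqxx.
  case: (leP (x i - 1) (x j)) => // lt.
  have : x k = Num.max (x i) (x j) by apply: h; rewrite gtr0_norm; lra.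
  by rewrite kj max_l; lra.
Qed.

Definition sort_goal e (S : seq 'I_n) (K : knowledge R n) :=
  exists2 l, perm_eq l S & forall x, K x -> ascending e x l.

Lemma sort_goal_antitone e S : antitone (sort_goal e S).
Proof. by move=> K K' sK [l pl h]; exists l => // x /sK /h. Qed.

Lemma sort_all_pairs l K : uniq l ->
  reach 1 ((size l)%:R ^+ 2 / 2) K (sort_goal 2 l).
Proof.
move=> ul.
pose Q : {set comparison n} :=
  [set c : comparison n | [&& c.1 \in l, c.2 \in l & (c.1 < c.2)%N]].
(* The mirror image of [Q], disjoint from it and of the same size; hence [Q] fills at most half of
   the square. *)
pose Q' : {set comparison n} :=
  [set c : comparison n | [&& c.1 \in l, c.2 \in l & (c.2 < c.1)%N]].
have cQ : (#|Q| + #|Q| <= size l * size l)%N.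
  have cQ' : #|Q'| = #|Q|.
    pose sw (c : comparison n) : comparison n := (c.2, c.1).
    have sw_inj : injective sw by move=> [a b] [a' b'] [-> ->].
    rewrite -(card_imset _ sw_inj).
    apply: eq_card => -[i j]; rewrite !inE /=.
    apply/imsetP/idP => [[[a b]]|h]; first by rewrite inE /= => h [-> ->]; rewrite andbCA.
    by exists (j, i) => //; rewrite inE /= andbCA.
  rewrite -{2}cQ' -cardsUI.
  rewrite (_ : Q :&: Q' = finset.set0) ?cards0 ?addn0; last first.
    by apply/setP => -[i j]; rewrite !inE /=; apply/negbTE; lia.
  have -> : (size l = #|[set i in l]|)%N by rewrite cardsE (card_uniqP ul).
  rewrite -cardsX; apply: subset_leq_card; apply/fintype.subsetP => -[i j].
  by rewrite !inE /=; lia.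
exists Q => r; split.
  rewrite subr_ge0 ler_pdivlMr ?ltr0n // -natrX -natrM ler_nat; lia.
pose beats (i j : 'I_n) := if (i < j)%N then r (i, j) == i else r (j, i) == i.
have [l' pl' h] := sort_by_wins beats l; exists l' => // x [_ vx]; apply: h.
move=> i j il jl nij; rewrite /beats; case: ltnP => ltij.
  have /valid_answer_le[h1 h2] : valid_answer x (i, j) (r (i, j)).
    by apply: vx; rewrite inE /= il jl.
  split; first by move/eqP/h1.
  by move=> lt; apply/negP => /negP /h2; lra.
have ltji : (j < i)%N by rewrite ltn_neqAle ltij andbT eq_sym; exact: nij.
have v : valid_answer x (j, i) (r (j, i)).
  by apply: vx; rewrite inE /= il jl.
have /valid_answer_le[h1 h2] := v.
split; first by move=> /eqP e; apply: h2; rewrite e; exact: nij.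
move=> lt; case: v => /= -[e|->//] _; have := h1 e; lra.
Qed.

End Wins.

(** * Counting in lists, samples of a sorted group, and certified ranges *)

Lemma count_le1 (T : eqType) (a : pred T) (s : seq T) : uniq s ->
  {in s &, forall x y, a x -> a y -> x = y} -> (count a s <= 1)%N.
Proof.
move=> us h; rewrite -size_filter.
case E: (seq.filter a s) => [|x [|y t]] //.
have := filter_uniq a us; rewrite E /= inE negb_or => /andP[/andP[/eqP nxy _] _].
have := mem_filter a x s; have := mem_filter a y s; rewrite E !inE !eqxx ?orbT.
by move=> /esym/andP[ay ys] /esym/andP[ax xs]; case: nxy; apply: h.
Qed.

Lemma bigmax_attained (T : eqType) (s : seq T) (F : T -> nat) :
  (0 < \max_(i <- s) F i)%N -> exists2 i, i \in s & F i = \max_(i <- s) F i.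
Proof.
elim: s => [|i s IH]; first by rewrite big_nil.
rewrite big_cons; case: (leqP (F i) (\max_(j <- s) F j)) => [le|lt] h.
  by have [j js e] := IH h; exists j => //; rewrite inE js orbT.
by exists i; rewrite // inE eqxx.
Qed.

(** Each quotient comes from at most [f] indices; the successor accounts for the incomplete last
    block. *)
Lemma count_divn_le (f m : nat) (a : pred nat) : (0 < f)%N ->
  (count (fun i => a (i %/ f)%N) (iota 0 m) <= f * count a (iota 0 (m %/ f).+1))%N.
Proof.
move=> f0.
have count_block p k : (k <= f)%N ->
    count (fun i => a (i %/ f)%N) (iota (p * f)%N k) = (a p * k)%N.
  elim: k => [|k IH] lek; first by rewrite muln0.
  rewrite -addn1 iotaD count_cat IH ?(ltnW lek) //= addn0 divnMDl //.
  by rewrite divn_small // addn0 mulnDr muln1.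
have count_mul p : count (fun i => a (i %/ f)%N) (iota 0 (p * f)%N) =
    (f * count a (iota 0 p))%N.
  elim: p => [|p IH]; first by rewrite mul0n muln0.
  rewrite mulSnr iotaD count_cat IH add0n count_block //.
  by rewrite -addn1 iotaD count_cat /= addn0 mulnDr [(a _ * _)%N]mulnC.
rewrite -count_mul.
rewrite -(subnKC (ltnW (ltn_ceil m f0))) iotaD count_cat.
exact: leq_addr.
Qed.

Section Sampling.
Variables (R : realType) (n : nat) (z0 : 'I_n) (f : nat).
Hypothesis f_gt0 : (0 < f)%N.
Implicit Types (x : 'I_n -> R) (l S T q : seq 'I_n) (K : knowledge R n).

Definition samples l := [seq nth z0 l (j * f + f.-1)%N | j <- iota 0 (size l %/ f)%N].

Lemma size_samples l : size (samples l) = (size l %/ f)%N.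
Proof. by rewrite size_map size_iota. Qed.

Lemma sample_pos_lt l j : (j < size l %/ f)%N -> (j * f + f.-1 < size l)%N.
Proof.
move=> jl; have := leq_divM (size l) f.
have : (j.+1 * f <= size l %/ f * f)%N by rewrite leq_mul2r jl orbT.
by rewrite mulSnr; lia.
Qed.

Lemma nth_samples l j : (j < size l %/ f)%N ->
  nth z0 (samples l) j = nth z0 l (j * f + f.-1)%N.
Proof. by move=> h; rewrite (nth_map 0%N) ?size_iota // nth_iota. Qed.

Lemma samples_sub l : {subset samples l <= l}.
Proof.
move=> z /mapP[j]; rewrite mem_iota /= add0n => jl ->; apply: mem_nth.
exact: sample_pos_lt.
Qed.

Lemma samples_uniq l : uniq l -> uniq (samples l).
Proof.
move=> ul; rewrite map_inj_in_uniq ?iota_uniq // => i j.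
rewrite !mem_iota /= !add0n => il jl /eqP.
rewrite nth_uniq ?sample_pos_lt // => /eqP /addIn /eqP.
by rewrite eqn_pmul2r // => /eqP.
Qed.

(* The invariant linking a set S to pivots T sampled tau rounds earlier,
   whatever the order q in which T will be arranged: the item z is at most
   q_(H z) + 2 tau and at least q_(L z - 1) - 2 tau; L z = 0 and
   H z > size q mean that no such bound is known. *)
Definition sampled (tau U B : nat) S K :=
  exists T, [/\ uniq T, {subset T <= S}, (size T <= B)%N &
    forall q, perm_eq q T -> exists L H : 'I_n -> nat,
    [/\ forall z, z \in S -> (L z <= size q)%N,
        forall c, (c <= size q)%N ->
          (count (fun z => H z == c) S <= f ^ tau)%N,
        forall c, (c <= size q)%N ->
          (count (fun z => L z <= c < H z)%N S <= U)%N &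
        forall x, K x -> forall z, z \in S ->
          ((0 < L z)%N -> x (nth z0 q (L z).-1) - (2 * tau)%:R <= x z) /\
          ((H z < size q)%N -> x z <= x (nth z0 q (H z)) + (2 * tau)%:R)]].

Lemma sampled_antitone tau U B S : antitone (sampled tau U B S).
Proof.
move=> K K' sK [T [uT sT bT h]]; exists T; split=> // q /h[L [H [h1 h2 h3 h4]]].
by exists L, H; split=> // x /sK /h4.
Qed.

(** All items serve as pivots, and each is its own bound on both sides; [L z] is then [H z + 1], so
    nothing is undecided. *)
Lemma sampled0 B S K : uniq S -> (size S <= B)%N -> sampled 0 0 B S K.
Proof.
move=> uS szS; exists S; split=> // q pq.
exists (fun z => (index z q).+1), (fun z => index z q); split.
- by move=> z; rewrite -(perm_mem pq) index_mem.
- move=> c _; apply: count_le1 => // y z; rewrite -!(perm_mem pq) => yq zq.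
  by move=> /eqP yc /eqP zc; rewrite -(nth_index z0 yq) yc -zc nth_index.
- move=> c _; rewrite leqNgt -has_count; apply/hasPn => z _ /=.
  by apply/negP; lia.
- by move=> x _ z; rewrite -(perm_mem pq) => zq /=; rewrite nth_index //; lra.
Qed.

(* A group in sorted order is cut into blocks of f items ended by a sample.
   An item of block j lies below the sample ending its block and above all the
   samples of earlier blocks. *)
Definition block_lower (L : 'I_n -> nat) l j :=
  \max_(p <- take j (samples l)) L p.

(** No sample closes the incomplete last block; [top] stands for a missing upper bound. *)
Definition block_upper (H : 'I_n -> nat) top l j :=
  if (j < size l %/ f)%N then H (nth z0 (samples l) j) else top.

Lemma count_by_block l (a : pred nat) : uniq l ->
  (count (fun z => a (index z l %/ f)%N) l <=
   f * count a (iota 0 (size l %/ f)%N.+1))%N.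
Proof.
move=> ul; apply: leq_trans (count_divn_le _ _ f_gt0).
rewrite -[X in (count _ X <= _)%N](mkseq_nth z0 l) count_map; apply: eq_leq.
by apply: eq_in_count => i; rewrite mem_iota /= => il; rewrite index_uniq.
Qed.

(** As [c < top], the incomplete last block does not count, and each sample with [H p = c] answers
    for the [f] items of its block. *)
Lemma count_block_upper H top l c : uniq l -> (c < top)%N ->
  (count (fun z => block_upper H top l (index z l %/ f)%N == c) l <=
   f * count (fun p => H p == c) (samples l))%N.
Proof.
move=> ul ct; apply: leq_trans
  (count_by_block (fun j => block_upper H top l j == c) ul) _.
rewrite leq_mul2l; apply/orP; right.
rewrite -addn1 iotaD count_cat /= /block_upper add0n ltnn (gtn_eqF ct) !addn0.
rewrite count_map; apply: eq_leq; apply: eq_in_count => j.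
by rewrite mem_iota /= => jl; rewrite jl nth_samples.
Qed.

(* If two blocks j1 < j2 are both undecided at c, then so is the sample ending
   block j1. *)
Lemma count_block_undecided L H top l c : uniq l ->
  (count (fun z => block_lower L l (index z l %/ f)%N <= c <
                   block_upper H top l (index z l %/ f)%N)%N l <=
   f * (1 + count (fun p => L p <= c < H p)%N (samples l)))%N.
Proof.
move=> ul.
set a := fun j => (block_lower L l j <= c < block_upper H top l j)%N.
apply: leq_trans (count_by_block a ul) _; rewrite leq_mul2l; apply/orP; right.
pose b j := (j < size l %/ f)%N &&
  (L (nth z0 (samples l) j) <= c < H (nth z0 (samples l) j))%N.
have -> : count (fun p => L p <= c < H p)%N (samples l) =
    count b (iota 0 (size l %/ f)%N.+1).
  rewrite -[X in iota 0 X]addn1 iotaD count_cat /= add0n {2}/b ltnn !addn0.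
  rewrite count_map; apply: eq_in_count => j; rewrite mem_iota /= => jl.
  by rewrite /b jl nth_samples.
set s := iota _ _.
(* Undecided blocks closed by an undecided sample are counted by [b]; at most one other exists. *)
apply: (@leq_trans (count (predU (predI a (predC b)) b) s)).
  by apply: sub_count => j /= ->; case: (b j).
apply: (@leq_trans (count (predI a (predC b)) s + count b s)).
  by rewrite -count_predUI leq_addr.
rewrite leq_add2r; apply: count_le1; first exact: iota_uniq.
suff lt_absurd j1 j2 : j2 \in s -> (j1 < j2)%N -> a j1 -> ~~ b j1 -> ~ a j2.
  move=> j1 j2 s1 s2 /= /andP[a1 b1] /andP[a2 b2].
  by case: (ltngtP j1 j2) => // lt; [case: (lt_absurd j1 j2) | case: (lt_absurd j2 j1)].
rewrite mem_iota add0n ltnS => /= j2r lt12 /andP[_ up1] nb1 /andP[lo2 _].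
have j1r : (j1 < size l %/ f)%N by apply: leq_trans j2r.
move/negP: nb1; apply; rewrite /b j1r /=; apply/andP; split; last first.
  by move: up1; rewrite /block_upper j1r.
apply: leq_trans lo2; rewrite /block_lower.
have p1 : nth z0 (samples l) j1 \in take j2 (samples l).
  by rewrite -(nth_take z0 lt12) mem_nth // size_takel ?size_samples.
by rewrite (big_rem _ p1) /= leq_maxl.
Qed.
End Sampling.

(** * One sampling level over many groups *)

Lemma split_groups (T : eqType) (g : nat) (S : seq T) : (0 < g)%N ->
  exists LL : seq (seq T), [/\ flatten LL = S,
    forall l, l \in LL -> (size l <= g)%N & (size LL <= (size S %/ g).+1)%N].
Proof.
move=> g0; have [m] := ubnP (size S); elim: m S => // m IH S; rewrite ltnS => Sm.
have [leS|ltS] := leqP (size S) g.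
  exists [:: S]; split=> //=; first by rewrite cats0.
  by move=> l; rewrite inE => /eqP ->.
have [|LL [fL sL nL]] := IH (drop g S); first by rewrite size_drop; lia.
exists (take g S :: LL); split=> /=.
- by rewrite fL cat_take_drop.
- by move=> l; rewrite inE => /orP[/eqP->|/sL//]; rewrite size_take_min geq_minl.
- rewrite -{1}(subnKC (ltnW ltS)) divnDl // divnn g0 add1n ltnS.
  by rewrite size_drop in nL.
Qed.

Lemma group_of_member (T : eqType) (LL : seq (seq T)) : uniq (flatten LL) ->
  exists g : T -> seq T, forall l z, l \in LL -> z \in l -> g z = l.
Proof.
elim: LL => [|l0 LL IH] /=; first by exists (fun=> [::]).
rewrite cat_uniq => /and3P[_ /hasPn dj /IH[g hg]].
exists (fun z => if z \in l0 then l0 else g z) => l z.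
rewrite inE => /orP[/eqP -> -> //|lL zl].
rewrite (negbTE (dj z _)) ?(hg l) //.
by apply/flattenP; exists l.
Qed.

Lemma count_flatten_le (T : eqType) (LL : seq (seq T)) (F : seq T -> seq T)
    (a a1 : pred T) (f u : nat) :
  (forall l, l \in LL -> (count a l <= f * (u + count a1 (F l)))%N) ->
  (count a (flatten LL) <= f * (size LL * u + count a1 (flatten (map F LL))))%N.
Proof.
elim: LL => [|l LL IH] h //=; rewrite !count_cat.
have h1 := h l (mem_head _ _).
have {}IH : (count a (flatten LL) <=
    f * (size LL * u + count a1 (flatten (map F LL))))%N.
  by apply: IH => l' lL; apply: h; rewrite inE lL orbT.
by nia.
Qed.

Section Sort.
Variables (R : realType) (n : nat) (z0 : 'I_n) (f : nat).
Hypothesis f_gt0 : (0 < f)%N.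
Implicit Types (x : 'I_n -> R) (l S T q : seq 'I_n) (K : knowledge R n).

Lemma ascending_nth e x l i j : ascending e x l -> (i < j < size l)%N ->
  x (nth z0 l i) - e <= x (nth z0 l j).
Proof.
move=> /(pairwiseP z0) h /andP[ij jl]; apply: h => //.
by rewrite inE (ltn_trans ij).
Qed.

Lemma ascending_weaken e e' x l : e <= e' -> ascending e x l ->
  ascending e' x l.
Proof. by move=> le; apply: sub_pairwise => i j; lra. Qed.

Lemma samples_flatten_uniq (LL : seq (seq 'I_n)) : uniq (flatten LL) ->
  uniq (flatten (map (samples z0 f) LL)).
Proof.
elim: LL => //= l LL IH; rewrite !cat_uniq => /and3P[ul /hasPn dj /IH ->].
rewrite samples_uniq //= andbT; apply/hasPn => z /flattenP[_ /mapP[l' lL ->]] zl'.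
apply/negP => zl; have := dj z; rewrite (samples_sub f_gt0 zl) => /(_ _)/negP.
apply=> //; apply/flattenP; exists l' => //; exact: (samples_sub f_gt0) zl'.
Qed.

Lemma samples_flatten_size (LL : seq (seq 'I_n)) :
  (size (flatten (map (samples z0 f) LL)) * f <= size (flatten LL))%N.
Proof.
elim: LL => //= l LL IH; rewrite !size_cat size_samples mulnDl.
by rewrite leq_add // leq_divM.
Qed.

(** A sample stands for [f] items, and each group adds at most one undecided block of its own.
    Passing from an item to a sample of its sorted group adds 2 to the error. *)
Lemma sampled_step tau U B S K (LL : seq (seq 'I_n)) :
  uniq S -> perm_eq (flatten LL) S ->
  (forall x, K x -> forall l, l \in LL -> ascending 2 x l) ->
  sampled z0 f tau U B (flatten (map (samples z0 f) LL)) K ->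
  sampled z0 f tau.+1 (f * (size LL + U))%N B S K.
Proof.
move=> uS pS srt [T [uT sT bT hT]].
have uL : uniq (flatten LL) by rewrite (perm_uniq pS).
have [grp grpE] := group_of_member uL.
have sS : {subset flatten (map (samples z0 f) LL) <= S}.
  move=> z /flattenP[_ /mapP[l lL ->] /(samples_sub f_gt0) zl].
  by rewrite -(perm_mem pS); apply/flattenP; exists l.
have ul l : l \in LL -> uniq l.
  move=> lL; have := uL; rewrite (perm_uniq (perm_flatten (perm_to_rem lL))) /=.
  by rewrite cat_uniq => /and3P[].
exists T; split=> //; first by move=> z /sT /sS.
move=> q /hT [L1 [H1 [L1q cH cU cert]]].
pose L z := block_lower z0 f L1 (grp z) (index z (grp z) %/ f)%N.
(* [(size q).+1] exceeds every slot [c <= size q], so it certifies nothing. *)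
pose H z := block_upper z0 f H1 (size q).+1 (grp z) (index z (grp z) %/ f)%N.
have in_group z : z \in S -> exists2 l, l \in LL & z \in l.
  by rewrite -(perm_mem pS) => /flattenP.
(* A positive maximum is attained by an actual earlier sample, whose certificate [z] inherits. *)
have L_att z : z \in S -> (0 < L z)%N -> exists2 j, (j < index z (grp z) %/ f)%N &
    (j < size (grp z) %/ f)%N /\ L1 (nth z0 (samples z0 f (grp z)) j) = L z.
  move=> zS /bigmax_attained[p pin Lp]; rewrite -[L z]Lp.
  case/(nthP z0): pin => j; rewrite size_take_min size_samples ltn_min.
  by move=> /andP[j1 j2] <-; exists j => //; rewrite nth_take.
have mem_samples z j : z \in S -> (j < size (grp z) %/ f)%N ->
    nth z0 (samples z0 f (grp z)) j \in flatten (map (samples z0 f) LL).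
  move=> /in_group[l lL zl]; rewrite (grpE l) // => jl.
  apply/flattenP; exists (samples z0 f l); first exact: map_f.
  by rewrite mem_nth ?size_samples.
exists L, H; split.
- move=> z zS; case: (posnP (L z)) => [-> //|Lz].
  have [j _ [j2 <-]] := L_att z zS Lz; exact/L1q/mem_samples.
- move=> c cq; rewrite -(seq.permP pS).
  apply: leq_trans (_ : f * (size LL * 0 +
      count (fun p => H1 p == c) (flatten (map (samples z0 f) LL))) <= _)%N.
    apply: count_flatten_le => l lL; rewrite add0n.
    apply: leq_trans (count_block_upper z0 f_gt0 H1 (ul l lL) (_ : c < (size q).+1)%N) => //.
    apply: eq_leq; apply: eq_in_count => z zl; by rewrite /H (grpE l).
  by rewrite muln0 add0n expnS leq_mul2l cH ?orbT.
- move=> c cq; rewrite -(seq.permP pS).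
  apply: leq_trans (_ : f * (size LL * 1 +
      count (fun p => L1 p <= c < H1 p)%N (flatten (map (samples z0 f) LL))) <= _)%N.
    apply: count_flatten_le => l lL.
    apply: leq_trans (count_block_undecided z0 f_gt0 L1 H1 (size q).+1 c (ul l lL)).
    by apply: eq_leq; apply: eq_in_count => z zl; rewrite /H /L (grpE l).
  by rewrite muln1 leq_mul2l leq_add2l cU ?orbT.
- move=> x Kx z zS.
  have [l lL zl] := in_group z zS.
  have srtl := srt x Kx l lL.
  have iz : (index z l < size l)%N by rewrite index_mem.
  have gz := grpE l z lL zl.
  have dv := divn_eq (index z l) f; have md := ltn_pmod (index z l) f_gt0.
  split=> [Lz|].
    have [j j1 [j2 Lj]] := L_att z zS Lz; have mj := mem_samples z j zS j2.
    have [/(_ _)] := cert x Kx _ mj; rewrite Lj => /(_ Lz) le1 _.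
    move: j1 j2 le1; rewrite gz => j1 j2; rewrite nth_samples // => le1.
    have le2 : x (nth z0 l (j * f + f.-1)%N) - 2 <= x (nth z0 l (index z l)).
      apply: ascending_nth srtl _; rewrite iz andbT.
      have : (j.+1 * f <= index z l %/ f * f)%N by rewrite leq_mul2r j1 orbT.
      by rewrite mulSnr; lia.
    rewrite nth_index // in le2; move: le1 le2.
    by rewrite mulnS natrD; lra.
  rewrite /H /block_upper gz; case: ifP => [jl Hq|_]; last by rewrite ltnNge leqnSn.
  have mj := mem_samples z _ zS; rewrite gz in mj.
  have [_ /(_ Hq) le1] := cert x Kx _ (mj _ jl).
  pose p := (index z l %/ f * f + f.-1)%N.
  have le2 : x z - 2 <= x (nth z0 (samples z0 f l) (index z l %/ f)).
    rewrite nth_samples // -/p.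
    case: (ltnP (index z l) p) => lt.
      have := ascending_nth srtl (i := index z l) (j := p); rewrite nth_index //.
      by apply; rewrite lt sample_pos_lt.
    have -> : p = index z l by apply/eqP; rewrite eqn_leq lt /=; rewrite /p; lia.
    by rewrite nth_index //; lra.
  by rewrite mulnS natrD; lra.
Qed.

End Sort.

(** * Sampling, bucketing and recursion as strategies *)

Lemma perm_flatten_map (I T : eqType) (F G : I -> seq T) (s : seq I) :
  (forall i, i \in s -> perm_eq (F i) (G i)) ->
  perm_eq (flatten (map F s)) (flatten (map G s)).
Proof.
elim: s => //= i s IH h; apply: perm_cat; first by apply: h; rewrite mem_head.
by apply: IH => j js; apply: h; rewrite inE js orbT.
Qed.

Section SortReach.
Variables (R : realType) (n : nat) (z0 : 'I_n) (f : nat).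
Hypothesis f_ge4 : (4 <= f)%N.
Implicit Types (x : 'I_n -> R) (l S T q : seq 'I_n) (K : knowledge R n).

Let f_gt0 : (0 < f)%N. Proof. exact: leq_trans f_ge4. Qed.

Definition groups_goal g S K := exists LL : seq (seq 'I_n),
  [/\ perm_eq (flatten LL) S, (size LL <= (size S %/ g).+1)%N &
      forall x, K x -> forall l, l \in LL -> ascending 2 x l].

Lemma sort_groups g S K : (0 < g)%N -> uniq S ->
  reach 1 ((size S)%:R * g%:R / 2) K (groups_goal g S).
Proof.
move=> g0 uS; have [LL [fL sL nL]] := split_groups S g0.
have uL l : l \in LL -> uniq l.
  move=> lL; have := uS; rewrite -fL (perm_uniq (perm_flatten (perm_to_rem lL))) /=.
  by rewrite cat_uniq => /and3P[].
have ant : antitone (fun K' => forall l, l \in LL -> sort_goal 2 l K').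
  by move=> K1 K2 s12 h l lL; apply: sort_goal_antitone (h l lL).
have H : reach 1 (\sum_(l <- LL) (size l)%:R ^+ 2 / 2) K
    (fun K' => forall l, l \in LL -> sort_goal 2 l K').
  apply: reach_all => l lL; first exact: sort_goal_antitone.
  exact/sort_all_pairs/uL.
have {}H : reach 1 ((size S)%:R * g%:R / 2) K
    (fun K' => forall l, l \in LL -> sort_goal 2 l K').
  apply: reach_weaken H => //; rewrite -fL size_flatten sumnE big_map.
  rewrite natr_sum !mulr_suml big_seq [leRHS]big_seq; apply: ler_sum => l lL.
  rewrite ler_wpM2r // expr2 ler_wpM2l // ler_nat; exact: sL.
apply: reach_imply H => K' _ h.
have /choice[srt hs] : forall l, exists l', l \in LL -> perm_eq l' l /\
    forall x, K' x -> ascending 2 x l'.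
  move=> l; case: (boolP (l \in LL)) => [/h[l' pl al]|_]; first by exists l'.
  by exists [::].
exists (map srt LL); split.
- rewrite -fL -[in X in perm_eq _ X](map_id LL).
  by apply: perm_flatten_map => l /hs[].
- by rewrite size_map.
- by move=> x Kx _ /mapP[l /hs[_ h'] ->]; apply: h'.
Qed.

(** The recurrence of [sampled_step]: at most [2 * f ^ t.+3] items in groups of [2 * A * f ^ 2] make
    at most [f ^ t.+1 %/ A + 1] groups. *)
Fixpoint undecided_bound (A tau : nat) : nat :=
  if tau is t.+1 then (f * ((f ^ t.+1 %/ A).+1 + undecided_bound A t))%N else 0%N.

(** The added 2 absorbs the rounding in the induction: [f * (u + 1) + 2 <= f * (u + 2)]. *)
Lemma undecided_boundP A tau : (0 < A)%N ->
  (A * (undecided_bound A tau + 2) <= tau * f ^ tau.+1 + 2 * A * f ^ tau)%N.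
Proof.
move=> A0; elim: tau => [|t IH] /=; first by rewrite expn0; lia.
have := leq_divM (f ^ t.+1) A; set w := (_ %/ _)%N => hw.
set u := undecided_bound A t in IH *.
have : (f * (A * (u + 2)) <= f * (t * f ^ t.+1 + 2 * A * f ^ t))%N.
  by rewrite leq_mul2l IH orbT.
have : (f * (w * A) <= f * f ^ t.+1)%N by rewrite leq_mul2l hw orbT.
have : (2 * A <= f * A)%N by rewrite leq_mul2r (leq_trans _ f_ge4) ?orbT.
by rewrite (expnS f t.+1); move: (expnS f t); nia.
Qed.

(** With [tau = A] the undecided items number less than [f ^ A.+1 + 2 * f ^ A], and
    [3 * f ^ A <= f ^ A.+1]. Buckets thus meet the size limit of the next recursive call. *)
Lemma bucket_bound A : (0 < A)%N ->
  (f ^ A + undecided_bound A A <= 2 * f ^ A.+1)%N.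
Proof.
move=> A0; have := undecided_boundP A A0.
have -> : (A * f ^ A.+1 + 2 * A * f ^ A = A * (f ^ A.+1 + 2 * f ^ A))%N by ring.
rewrite leq_pmul2l // => h.
have : (4 * f ^ A <= f * f ^ A)%N by rewrite leq_mul2r f_ge4 orbT.
by rewrite -expnS; lia.
Qed.

(** The first level costs [A * f ^ 2] per item; sizes then shrink by [f >= 4] per level, and the
    geometric series gives the factor 4/3. *)
Lemma reach_sampled A tau S K : (0 < A)%N -> uniq S ->
  (size S <= 2 * f ^ tau.+2)%N ->
  reach tau (4 / 3 * (size S)%:R * (A * f ^ 2)%:R) K
    (sampled z0 f tau (undecided_bound A tau) (2 * f ^ 2) S).
Proof.
move=> A0; elim: tau S K => [|t IH] S K uS szS.
  split; first by rewrite !mulr_ge0 ?divr_ge0.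
  exact: sampled0.
pose g := (2 * A * f ^ 2)%N.
have g0 : (0 < g)%N by rewrite !muln_gt0 A0 f_gt0.
(* Cost of all later levels together: a third of the first. *)
pose c2 : R := (size S)%:R / 3 * (A * f ^ 2)%:R.
suff: reach (1 + t) ((size S)%:R * g%:R / 2 + c2) K
    (sampled z0 f t.+1 (undecided_bound A t.+1) (2 * f ^ 2) S).
  apply: reach_weaken => //; first exact: sampled_antitone.
  by rewrite /c2 /g -mulnA natrM; lra.
apply: reach_seq (sort_groups K g0 uS) _ (@sampled_antitone _ _ _ _ _ _ _ _).
move=> K1 _ [LL [pL nL srt]].
set S1 := flatten (map (samples z0 f) LL).
have szS1 : (size S1 * f <= size S)%N.
  by rewrite -(perm_size pL); exact: samples_flatten_size.
have uS1 : uniq S1 by apply: samples_flatten_uniq; rewrite // (perm_uniq pL).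
have szS1' : (size S1 <= 2 * f ^ t.+2)%N.
  rewrite -(leq_pmul2r f_gt0); apply: leq_trans szS1 (leq_trans szS _).
  by rewrite -mulnA -expnSr.
have H := IH S1 K1 uS1 szS1'.
have {}H : reach t c2 K1 (sampled z0 f t (undecided_bound A t) (2 * f ^ 2) S1).
  apply: reach_weaken H => //; first exact: sampled_antitone.
  rewrite /c2 ler_wpM2r //.
  have : (size S1 * 4 <= size S)%N.
    by apply: leq_trans szS1; rewrite leq_mul2l f_ge4 orbT.
  by rewrite -(ler_nat R) natrM; lra.
apply: reach_imply H => K2 s21 smp.
have [|T [uT sT bT hT]] := sampled_step f_gt0 uS pL _ smp.
  by move=> x /s21; exact: srt.
exists T; split=> // q /hT[L [H [h1 h2 h3 h4]]]; exists L, H; split=> // c cq.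
apply: leq_trans (h3 c cq) _; rewrite /= leq_mul2l leq_add2r; apply/orP; right.
apply: leq_trans nL _; rewrite ltnS.
apply: leq_trans (leq_div2r g szS) _; rewrite /g -mulnA divnMl //.
by rewrite -[t.+3]addn2 expnD divnMr ?expn_gt0 ?f_gt0.
Qed.

Definition buckets M e S K := exists N (b : 'I_n -> nat),
  [/\ forall z, z \in S -> (b z < N)%N,
      forall c, (c < N)%N -> (count (fun z => b z == c) S <= M)%N &
      forall x, K x -> forall y z, y \in S -> z \in S -> (b y < b z)%N ->
        x y - e <= x z].

Lemma buckets_antitone M e S : antitone (buckets M e S).
Proof.
move=> K K' sK [N [b [h1 h2 h3]]]; exists N, b; split=> // x /sK; exact: h3.
Qed.

(** With the next lemma, turns a number of beaten pivots into one pivot, beaten or unbeaten, on the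
    right side of position [c]. *)
Lemma count_prefix_lt (a : pred 'I_n) q c : (c < count a q)%N ->
  exists j, [/\ (c <= j)%N, (j < size q)%N & a (nth z0 q j)].
Proof.
move=> h; have := h; rewrite -{1}(cat_take_drop c q) count_cat => h2.
have : (0 < count a (drop c q))%N.
  have := count_size a (take c q); rewrite size_take_min.
  by have := geq_minl c (size q); lia.
rewrite -has_count => /(hasP)[p /(nthP z0)[j jd <-] ap].
rewrite size_drop in jd; rewrite nth_drop in ap; exists (c + j)%N.
by split=> //; [exact: leq_addr | rewrite -ltn_subRL].
Qed.

Lemma count_prefix_ge (a : pred 'I_n) q c : (count a q <= c)%N ->
  (c < size q)%N -> exists2 j, (j <= c)%N & ~~ a (nth z0 q j).
Proof.
move=> h cq; have : has (predC a) (take c.+1 q).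
  rewrite has_predC; apply/negP; rewrite all_count size_takel // => /eqP e.
  have : (count a (take c.+1 q) <= count a q)%N.
    by rewrite -{2}(cat_take_drop c.+1 q) count_cat leq_addr.
  by rewrite e; lia.
case/(hasP) => p /(nthP z0)[j]; rewrite size_takel // => jc <- /=.
by rewrite nth_take // => ap; exists j.
Qed.

(* The comparisons suggest the bucket b0 z, the number of pivots beaten by z,
   which the adversary may place anywhere; clamping it between L z and H z is
   what keeps the buckets small. *)
Lemma reach_buckets tau U B S K : (0 < tau)%N -> uniq S ->
  sampled z0 f tau U B S K ->
  reach 1 ((size S)%:R * B%:R) K (buckets (f ^ tau + U) (4 * tau + 4)%:R S).
Proof.
move=> tau0 uS [T [uT sT bT hT]].
pose Q : {set comparison n} := [set c : comparison n | (c.1 \in S) && (c.2 \in T)].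
exists Q => r; split.
  rewrite subr_ge0 -natrM ler_nat; apply: (@leq_trans (size S * size T)).
    have -> : (size S = #|[set i in S]|)%N by rewrite cardsE (card_uniqP uS).
    have -> : (size T = #|[set i in T]|)%N by rewrite cardsE (card_uniqP uT).
    rewrite -cardsX; apply: subset_leq_card; apply/fintype.subsetP => -[i j].
    by rewrite !inE.
  by rewrite leq_mul2l bT orbT.
pose beats (i j : 'I_n) := r (i, j) == i.
have beatsP x : learn K Q r x -> forall z p, z \in S -> p \in T ->
    (beats z p -> x p - 1 <= x z) /\ (~~ beats z p -> x z - 1 <= x p).
  move=> [_ v] z p zS pT.
  have /valid_answer_le[h1 h2] : valid_answer x (z, p) (r (z, p)).
    by apply: v; rewrite inE /= zS.
  by split=> [/eqP/h1|/h2].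
(* As [T] lies in [S], the same answers contain a round-robin of the pivots. Their order is known
   only now, hence the quantification over [q] in [sampled]. *)
have [q pq qs] := sort_by_wins R beats T.
have {}qs x : learn K Q r x -> ascending 2 x q.
  move=> lx; apply: qs => i j iT jT nij.
  have [h1 h2] := beatsP x lx i j (sT _ iT) jT; split=> // lt.
  by apply: contraTT lt => /h2 le; rewrite -leNgt; lra.
have [L [H [Lq cH cU cert]]] := hT q pq.
pose b0 z := count (beats z) q.
pose b z := minn (H z) (maxn (L z) (b0 z)).
have bq z : z \in S -> (b z <= size q)%N.
  move=> zS; rewrite (leq_trans (geq_minr _ _)) // geq_max Lq //=.
  exact: count_size.
exists (size q).+1, b; split=> [z /bq //|c|x lx].
  (* By clamping, an item of bucket [c] has [H z = c] or [L z <= c < H z]. *)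
  rewrite ltnS => cq; apply: leq_trans (leq_add (cH c cq) (cU c cq)).
  rewrite -count_predUI; apply: leq_trans (leq_addr _ _).
  by apply: sub_count => z /eqP <- /=; rewrite /b; lia.
have Kx : K x by case: lx.
have qsx := qs x lx.
have near2 i j : (i <= j < size q)%N -> x (nth z0 q i) - 2 <= x (nth z0 q j).
  case: (ltngtP i j) => [ij jq|//|-> _]; last by lra.
  by apply: ascending_nth qsx _; rewrite ij.
have memq i : (i < size q)%N -> nth z0 q i \in T.
  by move=> iq; rewrite -(perm_mem pq) mem_nth.
(* Item against pivot: a certificate errs by [2 * tau] and the pivot order by 2. A direct comparison
   followed by the pivot order errs by 3, no more than [E] as [tau > 0]. *)
pose E : R := (2 * tau)%:R + 2.
have E3 : 3 <= E.
  have : (2 <= 2 * tau)%N by lia.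
  by rewrite -(ler_nat R) /E; lra.
have above z c : z \in S -> (c < b z)%N -> x (nth z0 q c) - E <= x z.
  move=> zS cb; have [cL _] := cert x Kx z zS.
  have : (c < maxn (L z) (b0 z))%N by apply: leq_trans cb (geq_minr _ _).
  rewrite leq_max => /orP[cLz|/count_prefix_lt[j [cj jq bj]]].
    have L0 := leq_ltn_trans (leq0n _) cLz; have := cL L0.
    have := near2 c (L z).-1; rewrite /E.
    have -> : (c <= (L z).-1 < size q)%N by rewrite -ltnS prednK // cLz Lq.
    by move=> /(_ isT); lra.
  have [/(_ bj) h _] := beatsP x lx z _ zS (memq j jq).
  by have := near2 c j; rewrite cj jq => /(_ isT); lra.
have below z c : z \in S -> (b z <= c < size q)%N -> x z <= x (nth z0 q c) + E.
  move=> zS /andP[bc cq]; have [_ cHz] := cert x Kx z zS.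
  move: bc; rewrite geq_min => /orP[Hc|].
    have := cHz (leq_ltn_trans Hc cq).
    by have := near2 (H z) c; rewrite Hc cq /E => /(_ isT); lra.
  rewrite geq_max => /andP[_ /count_prefix_ge/(_ cq)[j jc bj]].
  have [_ /(_ bj) h] := beatsP x lx z _ zS (memq j (leq_ltn_trans jc cq)).
  by have := near2 j c; rewrite jc cq => /(_ isT); lra.
(* The pivot at position [b y] separates [y] from [z], at the cost of [E] on each side. *)
move=> y z yS zS byz.
have hz := above z (b y) zS byz.
have hy : x y <= x (nth z0 q (b y)) + E.
  by apply: below => //; rewrite leqnn (leq_trans byz) ?bq.
have -> : (4 * tau + 4)%:R = E + E :> R by rewrite /E natrD !natrM; lra.
by lra.
Qed.

Lemma perm_buckets N (b : 'I_n -> nat) S : (forall z, z \in S -> (b z < N)%N) ->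
  perm_eq (flatten [seq [seq z <- S | b z == c] | c <- iota 0 N]) S.
Proof.
move=> bN; have e : [seq z <- S | (b z < N)%N] = S by apply/all_filterP/allP.
rewrite -{2}e => {e bN}; elim: N => [|N IH]; first by rewrite /= filter_pred0.
rewrite -[N.+1]addn1 iotaD map_cat flatten_cat /= cats0 add0n addn1.
rewrite perm_sym -(perm_filterC (fun z => (b z < N)%N)) perm_sym.
rewrite -!filter_predI; apply: perm_cat.
  apply: perm_trans IH _; rewrite (@eq_filter _ _ (fun z => b z < N)%N) //.
  by move=> z /=; lia.
rewrite (@eq_filter _ _ (fun z => b z == N)) // => z /=; lia.
Qed.

(** Per item: [4/3 * j * f ^ 2] for sampling and [2 * f ^ 2] for pivots, summed over levels [j] from
    1 to [a], plus [f ^ 2] for the final round-robins. *)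
Definition sort_cost (a : nat) : R :=
  f%:R ^+ 2 * (1 + 2 / 3 * (a * a.+1)%:R + 2 * a%:R).

Fixpoint sort_rounds (a : nat) : nat :=
  if a is a'.+1 then (a + (1 + sort_rounds a'))%N else 1%N.

(** Errors do not add up along the recursion: a pair is either separated at this level, with error
    [4 * A + 4], or shares a bucket and gets the smaller recursive error. Costs per item do add up,
    as buckets partition [S]. *)
Lemma reach_sort a S K : uniq S -> (size S <= 2 * f ^ a.+2)%N ->
  reach (sort_rounds a) ((size S)%:R * sort_cost a) K
    (sort_goal (4 * a + 4)%:R S).
Proof.
elim: a S K => [|a IH] S K uS szS.
  apply: reach_imply (reach_weaken (@sort_goal_antitone _ _ _ _) _ _ (sort_all_pairs K uS)).
  - move=> K' _ [l pl h]; exists l => // x /h; apply: ascending_weaken.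
    by rewrite ler_nat.
  - rewrite expr2 -mulrA ler_wpM2l // /sort_cost -natrX mul0n !mulr0 !addr0 mulr1.
    by rewrite ler_pdivrMr ?ltr0n // -natrM ler_nat mulnC.
  - by [].
pose A := a.+1; rewrite -/A in szS *.
pose c1 : R := 4 / 3 * (size S)%:R * (A * f ^ 2)%:R.
pose c2 : R := (size S)%:R * (2 * f ^ 2)%:R.
pose c3 : R := (size S)%:R * sort_cost a.
have -> : (size S)%:R * sort_cost A = c1 + (c2 + c3).
  rewrite /c1 /c2 /c3 /sort_cost /A !natrM ?natrX.
  by rewrite -[a.+2%:R]natr1 -[a.+1%:R]natr1; field.
have aG := @sort_goal_antitone R n (4 * A + 4)%:R S.
apply: (reach_seq (reach_sampled K _ uS szS) _ aG) => // K1 _ smp.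
apply: (reach_seq (reach_buckets _ uS smp) _ aG) => // K2 _ [N [b [bN cb hb]]].
pose bk c := [seq z <- S | b z == c].
have H : reach (sort_rounds a) (\sum_(c <- iota 0 N) (size (bk c))%:R * sort_cost a) K2
    (fun K' => forall c, c \in iota 0 N -> sort_goal (4 * a + 4)%:R (bk c) K').
  apply: reach_all => c; first by move=> _; exact: sort_goal_antitone.
  rewrite mem_iota /= => cN; apply: IH; first exact: filter_uniq.
  rewrite size_filter; apply: leq_trans (cb c cN) _; exact: bucket_bound.
have pb := perm_buckets bN.
rewrite -mulr_suml -natr_sum (_ : (\sum_(c <- iota 0 N) size (bk c) = size S)%N) in H; last first.
  by rewrite -(perm_size pb) size_flatten sumnE !big_map.
apply: reach_imply H => K3 s32 h.
have /choice[srt hs] : forall c, exists l, c \in iota 0 N -> perm_eq l (bk c) /\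
    forall x, K3 x -> ascending (4 * a + 4)%:R x l.
  move=> c; case: (boolP (c \in iota 0 N)) => [/h[l pl al]|_]; first by exists l.
  by exists [::].
exists (flatten [seq srt c | c <- iota 0 N]).
  by apply: perm_trans pb; apply: perm_flatten_map => c /hs[].
move=> x Kx; have {}hb := hb x (s32 _ Kx).
have mem_srt c z : c \in iota 0 N -> z \in srt c -> z \in S /\ b z = c.
  move=> /hs[p _]; rewrite (perm_mem p) mem_filter => /andP[/eqP]; by split.
have asc c : c \in iota 0 N -> ascending (4 * A + 4)%:R x (srt c).
  move=> /hs[_ /(_ x Kx)]; apply: ascending_weaken.
  by rewrite ler_nat /A; lia.
have : pairwise ltn (iota 0 N) by rewrite -sorted_pairwise ?iota_ltn_sorted //; exact: ltn_trans.
elim: (iota 0 N) mem_srt asc => //= c s IHs mem_srt asc /andP[lts pw].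
rewrite /ascending pairwise_cat; apply/and3P; split.
- apply/allrelP => y z yc /flattenP[_ /mapP[c' c's ->] zc'].
  have [yS by_] := mem_srt c y (mem_head _ _) yc.
  have [|zS bz] := mem_srt c' z _ zc'; first by rewrite inE c's orbT.
  by apply: hb => //; rewrite by_ bz; exact: (allP lts).
- exact/asc/mem_head.
- apply: IHs pw => [c' z c's|c' c's]; last by apply: asc; rewrite inE c's orbT.
  by apply: mem_srt; rewrite inE c's orbT.
Qed.

End SortReach.

(** * Rounds used, and the deepest recursion that [d] rounds allow *)

Lemma sort_roundsE a : (2 * sort_rounds a = a ^ 2 + 3 * a + 2)%N.
Proof. by elim: a => //= a IH; rewrite !mulnDr IH; lia. Qed.

Lemma sort_rounds_le a b : (a <= b)%N -> (sort_rounds a <= sort_rounds b)%N.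
Proof.
move=> ab; rewrite -(leq_pmul2l (isT : 0 < 2)%N) !sort_roundsE.
by rewrite leq_add2r leq_add ?leq_mul2l ?leq_sqr ?ab ?orbT.
Qed.

Lemma sort_rounds_bracket d : (0 < d)%N ->
  exists k, (sort_rounds k <= d < sort_rounds k.+1)%N.
Proof.
elim: d => // -[|d] IH _; first by exists 0%N.
have [k /andP[h1 h2]] := IH isT.
have [lt|ge] := ltnP d.+2 (sort_rounds k.+1).
  by exists k; rewrite lt andbT (leq_trans h1).
exists k.+1; rewrite ge /=; have -> : d.+2 = sort_rounds k.+1 by lia.
by rewrite /=; lia.
Qed.

(** * Numerical estimates for the comparison budget *)

Section Budget.
Variable R : realType.

(** Eighth power of [1 - u <= expR (- u)] at [u = 33/400], since [(1 - u) ^+ 8] still exceeds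
    1/2. *)
Lemma ln2_ge : 33 / 50 <= ln 2 :> R.
Proof.
have h : 1 - 33 / 400 <= expR (- (33 / 400)) :> R by apply: expR_ge1Dx.
have h8 : (1 - 33 / 400) ^+ 8 <= expR (- (33 / 400)) ^+ 8 :> R.
  by rewrite lerXn2r ?nnegrE ?expR_ge0 //; lra.
rewrite -expRM_natl in h8.
rewrite -ler_expR lnK ?posrE // -[leRHS]invrK -[leLHS]invrK lef_pV2 ?posrE ?invr_gt0 ?expR_gt0 //.
rewrite -expRN (_ : - (33 / 50) = 8%:R * - (33 / 400)); last by field.
by apply: le_trans h8; lra.
Qed.

Lemma expR1_ge : 263 / 100 <= expR 1 :> R.
Proof.
have h : 1 + 1 / 16 <= expR (1 / 16) :> R by apply: expR_ge1Dx.
have h16 : (1 + 1 / 16) ^+ 16 <= expR (1 / 16) ^+ 16 :> R.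
  by rewrite lerXn2r ?nnegrE ?expR_ge0 //; lra.
rewrite -expRM_natl (_ : 16%:R * (1 / 16) = 1 :> R) in h16; last by field.
by apply: le_trans h16; lra.
Qed.

(** The tangent of the exponential at 1 passes through the origin. *)
Lemma expR_ge_linear (y : R) : expR 1 * y <= expR y.
Proof.
rewrite (_ : expR y = expR 1 * expR (y - 1)); last by rewrite -expRD addrC subrK.
by rewrite ler_wpM2l ?expR_ge0 //; have := expR_ge1Dx (y - 1); lra.
Qed.

Variables (n d : nat).
Hypotheses (n_gt0 : (0 < n)%N) (d_gt0 : (0 < d)%N).
Let r : R := Num.sqrt d%:R.
Let X : R := n%:R `^ (2 / r).

Let r_gt0 : 0 < r. Proof. by rewrite sqrtr_gt0 ltr0n. Qed.
Let r2 : r ^+ 2 = d%:R. Proof. by rewrite sqr_sqrtr. Qed.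
Let n_ge1 : 1 <= n%:R :> R. Proof. by rewrite ler1n. Qed.

Lemma budgetE : n%:R `^ (1 + 2 / r) * d%:R = n%:R * (X * d%:R).
Proof.
rewrite powRD; first by rewrite powRr1 ?ler0n // mulrA.
by apply/implyP => _; rewrite pnatr_eq0 -lt0n.
Qed.

Lemma budget_exponent (p : R) : p * r <= 2 -> n%:R `^ p <= X.
Proof. by move=> h; apply: ler_powR => //; rewrite ler_pdivlMr. Qed.

(** The exponent [2 / r] is at least 1 for [d <= 4] and at least 1/2 for [d <= 16]; beyond that,
    [d >= 17] alone exceeds [n / 2 <= 16]. *)
Lemma all_pairs_budget : (d <= 4)%N || (n <= 32)%N -> n%:R / 2 <= X * d%:R.
Proof.
move=> dn; have n1 := n_ge1; have d1 : 1 <= d%:R :> R by rewrite ler1n.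
have [d4|d4] := leqP d 4.
  have h : n%:R `^ 1 <= X.
    apply: budget_exponent; rewrite mul1r -(@ler_pXn2r _ 2) ?nnegrE ?(ltW r_gt0) //.
    by rewrite r2 -natrX ler_nat.
  rewrite powRr1 ?ler0n // in h.
  have : n%:R * 1 <= X * d%:R by apply: ler_pM.
  by lra.
have {dn} n32 : n%:R <= 32 :> R by rewrite ler_nat; lia.
have [d16|d16] := leqP d 16.
  have h : n%:R `^ (2^-1) <= X.
    apply: budget_exponent; rewrite mulrC ler_pdivrMr // -natrM.
    rewrite -(@ler_pXn2r _ 2) ?nnegrE ?(ltW r_gt0) //.
    by rewrite r2 -natrX ler_nat.
  rewrite powR12_sqrt ?ler0n // in h.
  have w0 : 0 <= Num.sqrt (n%:R : R) by exact: sqrtr_ge0.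
  have w2 : Num.sqrt (n%:R : R) ^+ 2 = n%:R by rewrite sqr_sqrtr ?ler0n.
  have d5 : 5 <= d%:R :> R by rewrite ler_nat.
  set w := Num.sqrt _ in h w0 w2.
  have w6 : w <= 6 by nra.
  have : w * 5 <= X * d%:R by apply: ler_pM.
  by nra.
have h : n%:R `^ 0 <= X by apply: budget_exponent; rewrite mul0r.
have d17 : 17 <= d%:R :> R by rewrite ler_nat.
rewrite powRr0 in h.
have : 1 * 17 <= X * d%:R by apply: ler_pM.
by lra.
Qed.

(** The base [s - 1] being too small, and [k + 2 >= 4/3 * r], give
    [X >= (s - 1)^(8/3) >= 3/2 * s^2]; the cost per item is at most [3/2 * d * s^2]. *)
Lemma large_base_budget s k : (5 <= s)%N -> (2 * s.-1 ^ k.+2 < n)%N ->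
  (k ^ 2 + 3 * k + 2 <= 2 * d <= k ^ 2 + 5 * k + 4)%N ->
  sort_cost R s k <= X * d%:R.
Proof.
(* From here on [s] is the base minus one. *)
case: s => // s; rewrite ltnS [_.+1.-1]/= => s4 ns /andP[kd dk].
have s4R : 4 <= s%:R :> R by rewrite ler_nat.
have kdR : k%:R ^+ 2 + 3 * k%:R + 2 <= 2 * d%:R :> R.
  by rewrite -natrX -!natrM -!natrD ler_nat.
have dkR : 2 * d%:R <= k%:R ^+ 2 + 5 * k%:R + 4 :> R.
  by rewrite -natrX -!natrM -!natrD ler_nat.
have k0 : 0 <= k%:R :> R by rewrite ler0n.
(* After squaring, the upper bound on [d] leaves [9 (k + 2)^2 - 16 d >= (k - 2)^2]. *)
have rk : 4 / 3 * r <= k.+2%:R.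
  have r0 := r_gt0; rewrite -(@ler_pXn2r _ 2) ?nnegrE ?ler0n //; last by lra.
  rewrite exprMn r2 -[k.+2%:R]natr1 -natr1.
  by have := sqr_ge0 (k%:R - 2 : R); lra.
pose Y : R := s%:R `^ (8 / 3).
have Y0 : 0 <= Y by exact: powR_ge0.
have YX : Y <= X.
  apply: (@le_trans _ _ (s%:R `^ (k.+2%:R * (2 / r)))).
    apply: ler_powR; first by lra.
    by rewrite mulrA ler_pdivlMr //; nra.
  rewrite powRrM powR_mulrn ?ler0n //; apply: ge0_ler_powR.
  - by rewrite divr_ge0 ?(ltW r_gt0).
  - by rewrite nnegrE exprn_ge0 ?ler0n.
  - by rewrite nnegrE ler0n.
  - rewrite -natrX ler_nat; lia.
have Y3 : Y ^+ 3 = s%:R ^+ 8.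
  rewrite -powR_mulrn // -powRrM (_ : 8 / 3 * 3%:R = 8%:R) ?powR_mulrn ?ler0n //.
  by field.
have sS : s.+1%:R = s%:R + 1 :> R by rewrite -natr1.
have Ys : 3 / 2 * (s%:R + 1) ^+ 2 <= Y.
  rewrite -(@ler_pXn2r _ 3) ?nnegrE //.
  rewrite Y3 exprMn -exprM.
  have a1 : (s%:R + 1) <= 5 / 4 * s%:R :> R by lra.
  have a2 : (s%:R + 1) ^+ 6 <= (5 / 4 * s%:R) ^+ 6 :> R.
    by rewrite lerXn2r ?nnegrE //; lra.
  rewrite exprMn in a2.
  have a3 : 16 <= s%:R ^+ 2 :> R by nra.
  have a4 : 0 <= s%:R ^+ 6 :> R by rewrite exprn_ge0 ?ler0n.
  have -> : s%:R ^+ 8 = s%:R ^+ 2 * s%:R ^+ 6 :> R by rewrite -exprD.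
  have a5 : 16 * s%:R ^+ 6 <= s%:R ^+ 2 * s%:R ^+ 6 :> R by rewrite ler_wpM2r.
  by lra.
(* True because [k] is an integer. This product is 12 times the gap between [3/4 (k^2 + 3k + 2)], at
   most [3/2 d], and the second factor of [sort_cost]. *)
have int_k : 0 <= (k%:R - 2) * (k%:R - 3) :> R.
  case: k {ns kd dk kdR dkR k0 rk} => [|[|[|k]]]; try lra.
  by rewrite -natr1 -[k.+2%:R]natr1 -[k.+1%:R]natr1; have := ler0n R k; nra.
rewrite /sort_cost sS natrM -[k.+1%:R]natr1.
apply: (@le_trans _ _ ((s%:R + 1) ^+ 2 * (3 / 2 * d%:R))).
  by rewrite ler_wpM2l ?exprn_ge0 //; lra.
rewrite mulrA ler_wpM2r ?ler0n //; lra.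
Qed.

(* Here d n^(2 / sqrt d) >= (e ln n)^2, the minimum over all real d. *)
Lemma base4_budget k : (0 < k)%N -> (2 * 4 ^ k.+1 < n)%N ->
  sort_cost R 4 k <= X * d%:R.
Proof.
move=> k0 kn; pose L : R := ln n%:R.
have L_ge : (2 * k%:R + 3) * (33 / 50) <= L.
  have : (2 * k + 3)%:R * ln 2 <= L.
    rewrite mulr_natl -lnXn // /L ler_ln ?posrE ?exprn_gt0 ?ltr0n //.
    rewrite -natrX ler_nat (_ : 2 * k + 3 = 1 + 2 * k.+1)%N; last by lia.
    by rewrite expnD expnM; exact: ltnW.
  apply: le_trans; rewrite natrD natrM; apply: ler_wpM2l ln2_ge.
  by rewrite addr_ge0 ?mulr_ge0 ?ler0n.
have k1 : 1 <= k%:R :> R by rewrite ler1n.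
have e_ge := expR1_ge.
have eL : 263 / 100 * ((2 * k%:R + 3) * (33 / 50)) <= expR 1 * L.
  by apply: ler_pM => //; lra.
have XE : X = expR (L / r) ^+ 2.
  rewrite /X /powR pnatr_eq0 gtn_eqF // -expRM_natl -/L; congr expR.
  by rewrite mulrAC -mulrA.
have -> : X * d%:R = (r * expR (L / r)) ^+ 2 by rewrite exprMn r2 XE mulrC.
have rL : expR 1 * L <= r * expR (L / r).
  have := expR_ge_linear (L / r); rewrite mulrA ler_pdivrMr //.
  by rewrite [_ * r]mulrC.
apply: (@le_trans _ _ ((263 / 100 * ((2 * k%:R + 3) * (33 / 50))) ^+ 2)).
  rewrite /sort_cost natrM -[k.+1%:R]natr1.
  (* The two quadratics in [k] come closest near 5/2. *)
  by have := sqr_ge0 (k%:R - 5 / 2 : R); lra.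
by rewrite lerXn2r ?nnegrE //; nra.
Qed.

End Budget.

(** * Choice of parameters and conclusion *)

Section Assembly.
Variables (R : realType) (n : nat).

Lemma sort_goal_perm (e e' : R) (K : knowledge R n) : e <= e' ->
  sort_goal e (enum 'I_n) K ->
  exists s : 'S_n, forall x, K x -> approx_sorting e' x s.
Proof.
move=> le [l pl h].
have sz : size l = n by rewrite (perm_size pl) size_enum_ord.
have ul : uniq l by rewrite (perm_uniq pl) enum_uniq.
have inj : injective (fun i : 'I_n => nth i l i).
  move=> i j /eqP; rewrite (set_nth_default j i) ?sz ?ltn_ord //.
  by rewrite nth_uniq ?sz ?ltn_ord // => /eqP /ord_inj.
exists (perm inj) => x /h asc i j ij; rewrite /approx_ge !permE.
rewrite (set_nth_default i j) ?sz ?ltn_ord //.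
have := ascending_nth i asc (i := i) (j := j); rewrite ij sz ltn_ord => /(_ isT).
by lra.
Qed.

Definition sortable_within (d : nat) :=
  exists (t : nat) (c e : R), [/\ (t <= d)%N,
    c <= n%:R `^ (1 + 2 / Num.sqrt d%:R) * d%:R, e <= (2 * d)%:R &
    forall K, reach t c K (sort_goal e (enum 'I_n))].

(** Small cases use one round-robin. Otherwise [k] is the largest depth that [d] rounds allow and
    [s >= 4] the least base that accommodates [n] items. *)
Lemma all_sortable d : (0 < d)%N -> sortable_within d.
Proof.
move=> d0.
have all_pairs : n%:R ^+ 2 / 2 <= n%:R `^ (1 + 2 / Num.sqrt d%:R) * d%:R :> R ->
  sortable_within d.
  move=> hc; exists 1%N, (n%:R ^+ 2 / 2), 2; split=> //.
    by rewrite ler_nat; lia.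
  by move=> K; have := sort_all_pairs K (enum_uniq 'I_n); rewrite size_enum_ord.
have [n0|n0] := posnP n.
  by apply: all_pairs; rewrite {1}n0 expr0n mul0r mulr_ge0 ?powR_ge0.
have [small|] := boolP ((d <= 4)%N || (n <= 32)%N).
  apply: all_pairs; rewrite budgetE // expr2 -mulrA ler_wpM2l //.
  exact: all_pairs_budget.
rewrite negb_or -!ltnNge => /andP[d5 n33].
pose z0 : 'I_n := Ordinal n0.
have strategy s k : (4 <= s)%N -> (n <= 2 * s ^ k.+2)%N ->
    (sort_rounds k <= d)%N ->
    sort_cost R s k <= n%:R `^ (2 / Num.sqrt d%:R) * d%:R ->
  sortable_within d.
  move=> s4 ns kd hc.
  exists (sort_rounds k), (n%:R * sort_cost R s k), (4 * k + 4)%:R; split=> //.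
  - by rewrite budgetE // ler_wpM2l.
  (* For [k >= 2], [4k + 4 <= k^2 + 3k + 2 <= 2d]; for [k <= 1], [d >= 5] suffices. *)
  - rewrite ler_nat; have := sort_roundsE k; rewrite expnS expn1.
    by case: k {ns hc} kd => [|[|k]] kd; nia.
  - move=> K; have := reach_sort z0 s4 (a := k) K (enum_uniq 'I_n).
    by rewrite size_enum_ord; exact.
have [k /andP[kd dk]] := sort_rounds_bracket d0.
have ex_s : exists s, (4 <= s)%N && (n <= 2 * s ^ k.+2)%N.
  exists (n + 4)%N; rewrite leq_addl /=.
  apply: leq_trans (leq_addr 4 n) _; rewrite -[X in (X <= _)%N]expn1.
  apply: leq_trans (leq_pmull _ (isT : 0 < 2)%N).
  by rewrite leq_pexp2l // addn_gt0 orbT.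
have [s /andP[s4 ns] s_min] := ex_minnP ex_s.
have [s5|s5] := ltnP 4 s.
  apply: (strategy s k) => //; apply: large_base_budget => //.
    rewrite ltnNge; apply/negP => h; have := s_min s.-1; rewrite h andbT.
    by move=> /(_ _); lia.
  have := sort_roundsE k; have := sort_roundsE k.+1.
  by rewrite !expnS !expn0; lia.
have {s4 s5} s_eq : s = 4%N by lia.
rewrite s_eq in ns.
(* At base 4 depth [k] may exceed what [n] needs and cost too much; the least sufficient depth is
   taken. It is positive because [n > 32 = 2 * 4 ^ 2]. *)
have ex_k : exists k', (n <= 2 * 4 ^ k'.+2)%N by exists k.
have [k' nk' k'_min] := ex_minnP ex_k.
have k'k : (k' <= k)%N by exact: k'_min.
apply: (strategy 4%N k') => //.
  exact: leq_trans (sort_rounds_le k'k) kd.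
have k'0 : (0 < k')%N by case: (k') nk' => // nk'; move: n33; rewrite ltnNge nk'.
apply: base4_budget => //; rewrite ltnNge; apply/negP => h.
have := k'_min k'.-1; rewrite prednK // => /(_ h); lia.
Qed.

End Assembly.

Theorem theorem1p8 (R : realType) (d : nat) (hd : (0 < d)%N) :
  exists A : forall n : nat, algorithm n,
    forall n : nat,
      rounds (A n) = d /\
      forall (x : 'I_n -> R) (adv : adversary n),
        valid_adversary x adv ->
        (num_comparisons (A n) adv)%:R
          <= n%:R `^ (1 + 2 / Num.sqrt d%:R) * d%:R :> R /\
        approx_sorting (2 * d)%:R x (result (A n) adv).
Proof.
suff H : forall n, exists A : algorithm n, rounds A = d /\
    forall (x : 'I_n -> R) (adv : adversary n), valid_adversary x adv ->
      (num_comparisons A adv)%:R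
        <= n%:R `^ (1 + 2 / Num.sqrt d%:R) * d%:R :> R /\
      approx_sorting (2 * d)%:R x (result A adv).
  by exists (fun n => projT1 (cid (H n))) => n; exact: projT2 (cid (H n)).
move=> n; have [t [c [e [td hc he strat]]]] := all_sortable R n hd.
(* Idle rounds pad the strategy to exactly [d]; the initial knowledge excludes no values. *)
have strat_d := reach_idle (@sort_goal_antitone _ _ _ _) td (strat (fun=> True)).
have [A [rA hA]] :=
  algorithm_of_reach (fun K' => @sort_goal_perm R n e _ K' he) strat_d.
exists A; split=> // x adv vx; have [hn hs] := hA x adv I vx; split=> //.
exact: le_trans hc.
Qed.
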